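(* Let $\lambda\in\mathbb{C}\setminus\mathbb{Z}$ and $t\in\mathbb{C}\setminus\{0\}$. In the Lie algebra (with commutator bracket) of polynomial differential operators in one variable $u$, with $D=\frac{d}{du}$, consider $$x=u^2D-(\lambda-1)u,\qquad y=-D,\qquad z=t\,D^2,$$ and let $\mathfrak{sl}(\lambda)$ be the Lie subalgebra generated by $x,y,z$. Let $\mathfrak{F}$ be the free Lie algebra on three generators, also denoted $x,y,z$, and put $z_i=(\operatorname{ad}x)^i z$. Then the natural homomorphism $\mathfrak{F}\to\mathfrak{sl}(\lambda)$ (sending generators to the operators of the same name) is surjective, and its kernel is the ideal generated by the following relations: (0.1) $[[x,y],x]=2x$; (0.2) $[[x,y],y]=-2y$; (1.1) $[y,z]=0$; (1.2) $[[x,y],z]=-4z$; (1.3) $(\operatorname{ad}x)^5z=0$; (2.1) $3[z_1,z_2]-2[z,z_3]=24t^2(\lambda^2-4)\,y$; (3.1) $[z,[z,z_1]]=0$; (3.2) $4[z_3,[z,z_1]]-3[z_2,[z,z_2]]=576\,t^2(\lambda^2-9)\,z$.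
   Context: Here $\mathfrak{sl}(\lambda)$ is (for non-integer $\lambda$) the Lie algebra of ''traceless matrices of complex size $\lambda$'': the operators $-D$, $2uD-(\lambda-1)$, $u^2D-(\lambda-1)u$ span a copy of $\mathfrak{sl}(2)$ (images of $X^-,H,X^+$), the associative algebra they generate together with $1$ is $U(\mathfrak{sl}(2))$ modulo the ideal generated by $\Delta-\lambda^2+1$ with $\Delta=2(X^+X^-+X^-X^+)+H^2$, and $\mathfrak{sl}(\lambda)$ is the derived algebra of the associated Lie algebra. $\operatorname{ad}x(w)=[x,w]$. ''Relations'' are elements of $\mathfrak F$ of the form (left side) minus (right side). *)

(* Defs.v *)
From HB Require Import structures.
From mathcomp Require Import all_boot all_order all_algebra.
From mathcomp Require Import reals complex.
Set Implicit Arguments. Unset Strict Implicit. Unset Printing Implicit Defensive.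
Import Order.TTheory GRing.Theory Num.Theory.
Local Open Scope ring_scope.

(* Operators on C[u].  A polynomial differential operator sum_i p_i(u) D^i *)
(* is represented by its (faithful, char 0) action on {poly C}; the Lie    *)
(* bracket is the commutator of operators.                                 *)
Section Ops.
Variable C : fieldType.
Definition op := {poly C} -> {poly C}.
Definition op0 : op := fun _ => 0.
Definition opD (f g : op) : op := fun p => f p + g p.
Definition opZ (a : C) (f : op) : op := fun p => a *: f p.
Definition opBr (f g : op) : op := fun p => f (g p) - g (f p).

Inductive in_gen (gen : 'I_3 -> op) : op -> Prop :=
| IG_gen i : in_gen gen (gen i)
| IG_add f g : in_gen gen f -> in_gen gen g -> in_gen gen (opD f g)
| IG_scale a f : in_gen gen f -> in_gen gen (opZ a f)
| IG_br f g : in_gen gen f -> in_gen gen g -> in_gen gen (opBr f g).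
End Ops.

Definition opx (C : fieldType) (lam : C) : op C :=
  fun p => 'X ^+ 2 * p^`() - (lam - 1) *: ('X * p).
Definition opy (C : fieldType) : op C := fun p => - p^`().
Definition opz (C : fieldType) (t : C) : op C := fun p => t *: p^`(2).

Definition slgens (C : fieldType) (lam t : C) (i : 'I_3) : op C :=
  match val i with 0 => opx lam | 1 => @opy C | _ => opz t end.

(* Free Lie algebra on three generators over C: Lie terms modulo the       *)
(* congruence generated by the Lie algebra axioms; the quotient by the     *)
(* ideal generated by a set of relations Rel is obtained by adding r == 0  *)
(* for r in Rel.  Thus  lcong Rel w (LZero _)  <->  w lies in the ideal of *)
(* the free Lie algebra generated by Rel.                                  *)
Inductive lterm (C : Type) : Type :=
| LGen : 'I_3 -> lterm C
| LZero : lterm C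
| LAdd : lterm C -> lterm C -> lterm C
| LScale : C -> lterm C -> lterm C
| LBr : lterm C -> lterm C -> lterm C.
Arguments LGen {C}.
Arguments LZero {C}.

Section Free.
Variable C : fieldType.
Variable Rel : lterm C -> Prop.
Local Notation T := (lterm C).

Inductive lcong : T -> T -> Prop :=
| lc_refl a : lcong a a
| lc_sym a b : lcong a b -> lcong b a
| lc_trans a b c : lcong a b -> lcong b c -> lcong a c
| lc_add a a' b b' : lcong a a' -> lcong b b' -> lcong (LAdd a b) (LAdd a' b')
| lc_scale k a a' : lcong a a' -> lcong (LScale k a) (LScale k a')
| lc_br a a' b b' : lcong a a' -> lcong b b' -> lcong (LBr a b) (LBr a' b')
| lc_addA a b c : lcong (LAdd a (LAdd b c)) (LAdd (LAdd a b) c)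
| lc_addC a b : lcong (LAdd a b) (LAdd b a)
| lc_add0 a : lcong (LAdd LZero a) a
| lc_addN a : lcong (LAdd a (LScale (-1) a)) LZero
| lc_scale1 a : lcong (LScale 1 a) a
| lc_scaleA k l a : lcong (LScale k (LScale l a)) (LScale (k * l) a)
| lc_scaleDr k a b : lcong (LScale k (LAdd a b)) (LAdd (LScale k a) (LScale k b))
| lc_scaleDl k l a : lcong (LScale (k + l) a) (LAdd (LScale k a) (LScale l a))
| lc_brDl a b c : lcong (LBr (LAdd a b) c) (LAdd (LBr a c) (LBr b c))
| lc_brDr a b c : lcong (LBr a (LAdd b c)) (LAdd (LBr a b) (LBr a c))
| lc_brZl k a b : lcong (LBr (LScale k a) b) (LScale k (LBr a b))
| lc_brZr k a b : lcong (LBr a (LScale k b)) (LScale k (LBr a b))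
| lc_alt a : lcong (LBr a a) LZero
| lc_jacobi a b c :
    lcong (LAdd (LBr a (LBr b c)) (LAdd (LBr b (LBr c a)) (LBr c (LBr a b))))
          LZero
| lc_rel r : Rel r -> lcong r LZero.
End Free.

Fixpoint lieval (C : fieldType) (gen : 'I_3 -> op C) (w : lterm C) : op C :=
  match w with
  | LGen i => gen i
  | LZero => @op0 C
  | LAdd a b => opD (lieval gen a) (lieval gen b)
  | LScale k a => opZ k (lieval gen a)
  | LBr a b => opBr (lieval gen a) (lieval gen b)
  end.

Section Rels.
Variable C : fieldType.
Local Notation T := (lterm C).
Definition gx : T := LGen (@Ordinal 3 0 isT).
Definition gy : T := LGen (@Ordinal 3 1 isT).
Definition gz : T := LGen (@Ordinal 3 2 isT).
Definition lsub (a b : T) : T := LAdd a (LScale (-1) b).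
Fixpoint adx (i : nat) (w : T) : T :=
  match i with 0 => w | i'.+1 => LBr gx (adx i' w) end.
Definition zz (i : nat) : T := adx i gz.

Variables lam t : C.
Definition r01 := lsub (LBr (LBr gx gy) gx) (LScale 2 gx).
Definition r02 := lsub (LBr (LBr gx gy) gy) (LScale (-2) gy).
Definition r11 := LBr gy gz.
Definition r12 := lsub (LBr (LBr gx gy) gz) (LScale (-4) gz).
Definition r13 := adx 5 gz.
Definition r21 :=
  lsub (lsub (LScale 3 (LBr (zz 1) (zz 2))) (LScale 2 (LBr gz (zz 3))))
       (LScale (24 * t ^+ 2 * (lam ^+ 2 - 4)) gy).
Definition r31 := LBr gz (LBr gz (zz 1)).
Definition r32 :=
  lsub (lsub (LScale 4 (LBr (zz 3) (LBr gz (zz 1))))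
             (LScale 3 (LBr (zz 2) (LBr gz (zz 2)))))
       (LScale (576 * t ^+ 2 * (lam ^+ 2 - 9)) gz).

Definition sl_rels (r : T) : Prop :=
  r = r01 \/ r = r02 \/ r = r11 \/ r = r12 \/ r = r13 \/
  r = r21 \/ r = r31 \/ r = r32.
End Rels.

(* Main.v *)
(**
  Let L be the free Lie algebra modulo the relations.  Put w_1 = -2y, w_2 = z,
  let w_(n+1) be proportional to [[x,z], w_n], and let e_(n,k) be a multiple of
  (ad x)^k w_n, k <= 2n.  Modulo terms with fewer z's, e_(n,k) behaves like the
  monomial p^(2n-k) q^k of the Poisson algebra of even polynomials, so that one
  expects [e_(2,i), e_(n,k)] = (2ni - 4k) e_(n+1,i+k-1).  The error in this
  formula is compatible with ad x, hence for each r = i + k it is governed by a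
  single vector, the one with k = 0 and i = r.  This vector vanishes for r = 1
  by the choice of w_(n+1); for r = 0 by (3.1); for r = 2, 3, 4 because (2.1),
  applied to e_(n-1,r-2), gives a nonzero multiple of it, with the exception of
  r = n = 3, where (3.2) is needed.  Thus the e_(n,k) span L.  Since e_(n,k) acts
  as a differential operator of order n whose leading coefficient is a nonzero
  multiple of u^k, their images are linearly independent, and L embeds into the
  operators.  Only leading terms matter, so lambda plays no role.
*)
Require Import Defs.
From HB Require Import structures.
From mathcomp Require Import all_boot all_order all_algebra.
From mathcomp Require Import boolp reals complex.
From mathcomp Require Import ring zify.
Import Order.TTheory GRing.Theory Num.Theory.
Set Implicit Arguments. Unset Strict Implicit. Unset Printing Implicit Defensive.
Local Open Scope quotient_scope.
Local Open Scope ring_scope.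

(** * Equality of linear combinations by reflection *)

Section LinearCombinations.
Variables (C : comPzRingType) (V : lmodType C).

Inductive lcomb :=
  | LcVar of nat | LcZero | LcAdd of lcomb & lcomb | LcOpp of lcomb
  | LcScale of C & lcomb.

Fixpoint lc_eval (env : seq V) (u : lcomb) : V :=
  match u with
  | LcVar i => env`_i
  | LcZero => 0
  | LcAdd u1 u2 => lc_eval env u1 + lc_eval env u2
  | LcOpp u1 => - lc_eval env u1
  | LcScale k u1 => k *: lc_eval env u1
  end.

Fixpoint lc_coef (i : nat) (u : lcomb) : C :=
  match u with
  | LcVar j => if eqn i j then 1 else 0
  | LcZero => 0
  | LcAdd u1 u2 => lc_coef i u1 + lc_coef i u2
  | LcOpp u1 => - lc_coef i u1
  | LcScale k u1 => k * lc_coef i u1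
  end.

Lemma lc_evalE env u :
  lc_eval env u = \sum_(i < size env) lc_coef i u *: env`_i.
Proof.
elim: u => /= [j||u1 IH1 u2 IH2|u1 IH1|k u1 IH1].
- have [lt_j|le_j] := ltnP j (size env); last first.
    rewrite nth_default // big1 // => i _.
    case: eqnP => [eq_ij|_]; last by rewrite scale0r.
    by have := ltn_ord i; rewrite eq_ij ltnNge le_j.
  rewrite (bigD1 (Ordinal lt_j)) //= big1 ?addr0 => [|i].
    by case: eqnP => // _; rewrite scale1r.
  by rewrite -val_eqE -[eqn i j]/(val i == j) => /negPf->; rewrite scale0r.
- by rewrite big1 // => i _; rewrite scale0r.
- by rewrite IH1 IH2 -big_split; apply: eq_bigr => i _; rewrite scalerDl.
- by rewrite IH1 -sumrN; apply: eq_bigr => i _; rewrite scaleNr.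
- by rewrite IH1 scaler_sumr; apply: eq_bigr => i _; rewrite scalerA.
Qed.

(** A recursive proposition instead of a bounded quantifier: on a concrete list of atoms it computes
    to a conjunction of scalar identities, fit for [ring]. *)
Fixpoint lc_eq_upto (n : nat) (u v : lcomb) : Prop :=
  if n is n'.+1 then lc_coef n' u = lc_coef n' v /\ lc_eq_upto n' u v else True.

Lemma lc_eqP env u v : lc_eq_upto (size env) u v -> lc_eval env u = lc_eval env v.
Proof.
move=> eq_uv; rewrite !lc_evalE; apply: eq_bigr => i _; congr (_ *: _).
elim: (size env) (i : nat) (ltn_ord i) eq_uv => // n IHn k /=.
by rewrite ltnS leq_eqVlt => /predU1P[->|/IHn-IHk] [].
Qed.

End LinearCombinations.

Ltac lc_index v env :=
  lazymatch env with
  | v :: _ => constr:(0%N)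
  | _ :: ?env' => let i := lc_index v env' in constr:(S i)
  end.

Ltac lc_add_atom v env :=
  let rec mem l := lazymatch l with
    | nil => constr:(false) | v :: _ => constr:(true) | _ :: ?l' => mem l' end in
  lazymatch mem env with true => env | false => constr:(v :: env) end.

Ltac lc_atoms u env :=
  lazymatch u with
  | @Algebra.zero _ => env
  | @Algebra.add _ ?u1 ?u2 => let env1 := lc_atoms u1 env in lc_atoms u2 env1
  | @Algebra.opp _ ?u1 => lc_atoms u1 env
  | @GRing.scale _ _ _ ?u1 => lc_atoms u1 env
  | _ => lc_add_atom u env
  end.

Ltac lc_reify C u env :=
  lazymatch u with
  | @Algebra.zero _ => constr:(@LcZero C)
  | @Algebra.add _ ?u1 ?u2 =>
      let a := lc_reify C u1 env in let b := lc_reify C u2 env in constr:(@LcAdd C a b)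
  | @Algebra.opp _ ?u1 => let a := lc_reify C u1 env in constr:(@LcOpp C a)
  | @GRing.scale _ _ ?k ?u1 => let a := lc_reify C u1 env in constr:(@LcScale C k a)
  | _ => let i := lc_index u env in constr:(@LcVar C i)
  end.

(* Reduces an equation between linear combinations of vectors to the equality of
   the coefficients of each atom; [C] is the ring of scalars. *)
Ltac lincomb C :=
  lazymatch goal with |- @eq ?V ?u ?v =>
    let env0 := lc_atoms u (@nil V) in
    let env := lc_atoms v env0 in
    let a := lc_reify C u env in
    let b := lc_reify C v env in
    change (lc_eval env a = lc_eval env b);
    apply: lc_eqP; cbn [size lc_eq_upto lc_coef eqn]; repeat split
  end.

(** * The Lie algebra given by generators and relations, as a quotient of Lie terms *)

Section Presented.
Variables (C : fieldType) (Rel : lterm C -> Prop).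

(** The quotient construction asks for a boolean relation on a type with choice; classical logic
    provides both. *)
Definition lcongb : rel {classic lterm C} := fun a b => `[< lcong Rel a b >].

Lemma lcongb_refl : reflexive lcongb.
Proof. by move=> a; apply/asboolP; apply: lc_refl. Qed.

Lemma lcongb_sym : symmetric lcongb.
Proof. by move=> a b; apply/asboolP/asboolP => ?; apply: lc_sym. Qed.

Lemma lcongb_trans : transitive lcongb.
Proof.
by move=> b a c /asboolP ab /asboolP bc; apply/asboolP; apply: lc_trans bc.
Qed.

Canonical lcongb_equiv := EquivRel lcongb lcongb_refl lcongb_sym lcongb_trans.

Definition lalg := {eq_quot lcongb}.
HB.instance Definition _ := Choice.on lalg.

Definition lcls (a : lterm C) : lalg := \pi_lalg (a : {classic lterm C}).
Definition lrep (v : lalg) : lterm C := repr v.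

Lemma lrepK v : lcls (lrep v) = v. Proof. exact: reprK. Qed.

Lemma lclsP a b : lcls a = lcls b <-> lcong Rel a b.
Proof.
split=> [/eqP|ab]; first by rewrite /lcls eqmodE => /asboolP.
by apply/eqP; rewrite /lcls eqmodE; apply/asboolP.
Qed.

Lemma lrep_cls a : lcong Rel (lrep (lcls a)) a.
Proof. by apply/lclsP; rewrite lrepK. Qed.

Definition ladd u v := lcls (LAdd (lrep u) (lrep v)).
Definition lopp u := lcls (LScale (-1) (lrep u)).
Definition lscale k u := lcls (LScale k (lrep u)).
Definition lbr u v := lcls (LBr (lrep u) (lrep v)).

Lemma lcls_add a b : lcls (LAdd a b) = ladd (lcls a) (lcls b).
Proof. by apply/lclsP/lc_add; apply/lc_sym/lrep_cls. Qed.

Lemma lcls_scale k a : lcls (LScale k a) = lscale k (lcls a).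
Proof. by apply/lclsP/lc_scale/lc_sym/lrep_cls. Qed.

Lemma lcls_br a b : lcls (LBr a b) = lbr (lcls a) (lcls b).
Proof. by apply/lclsP/lc_br; apply/lc_sym/lrep_cls. Qed.

Lemma lcls_ind (P : lalg -> Prop) : (forall a, P (lcls a)) -> forall v, P v.
Proof. by move=> Pcls v; rewrite -(lrepK v). Qed.

Lemma laddA : associative ladd.
Proof.
elim/lcls_ind=> a; elim/lcls_ind=> b; elim/lcls_ind=> c.
by rewrite -!lcls_add; apply/lclsP/lc_addA.
Qed.

Lemma laddC : commutative ladd.
Proof.
elim/lcls_ind=> a; elim/lcls_ind=> b.
by rewrite -!lcls_add; apply/lclsP/lc_addC.
Qed.

Lemma ladd0 : left_id (lcls LZero) ladd.
Proof. by elim/lcls_ind=> a; rewrite -lcls_add; apply/lclsP/lc_add0. Qed.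

Lemma laddN : left_inverse (lcls LZero) lopp ladd.
Proof.
elim/lcls_ind=> a; rewrite /lopp -/(lscale _ _) -lcls_scale laddC -lcls_add.
exact/lclsP/lc_addN.
Qed.

HB.instance Definition _ := GRing.isZmodule.Build lalg laddA laddC ladd0 laddN.

Lemma lclsD a b : lcls (LAdd a b) = lcls a + lcls b.
Proof. exact: lcls_add. Qed.

Lemma lscaleA k l v : lscale k (lscale l v) = lscale (k * l) v.
Proof. by elim/lcls_ind: v => a; rewrite -!lcls_scale; apply/lclsP/lc_scaleA. Qed.

Lemma lscale1 : left_id 1 lscale.
Proof. by elim/lcls_ind=> a; rewrite -!lcls_scale; apply/lclsP/lc_scale1. Qed.

Lemma lscaleDr : right_distributive lscale +%R.
Proof.
move=> k; elim/lcls_ind=> a; elim/lcls_ind=> b.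
rewrite -lclsD -!lcls_scale -lclsD.
exact/lclsP/lc_scaleDr.
Qed.

Lemma lscaleDl v : {morph lscale^~ v : k l / k + l}.
Proof.
elim/lcls_ind: v => a k l; rewrite -!lcls_scale -lclsD.
exact/lclsP/lc_scaleDl.
Qed.

HB.instance Definition _ :=
  GRing.Zmodule_isLmodule.Build C lalg lscaleA lscale1 lscaleDr lscaleDl.

Lemma lclsZ k a : lcls (LScale k a) = k *: lcls a.
Proof. exact: lcls_scale. Qed.

Lemma lbrDl u v w : lbr (u + v) w = lbr u w + lbr v w.
Proof.
elim/lcls_ind: u => a; elim/lcls_ind: v => b; elim/lcls_ind: w => c.
by rewrite -lclsD -!lcls_br -lclsD; apply/lclsP/lc_brDl.
Qed.

Lemma lbrDr u v w : lbr u (v + w) = lbr u v + lbr u w.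
Proof.
elim/lcls_ind: u => a; elim/lcls_ind: v => b; elim/lcls_ind: w => c.
by rewrite -lclsD -!lcls_br -lclsD; apply/lclsP/lc_brDr.
Qed.

Lemma lbrZl k u v : lbr (k *: u) v = k *: lbr u v.
Proof.
elim/lcls_ind: u => a; elim/lcls_ind: v => b.
by rewrite -lclsZ -!lcls_br -lclsZ; apply/lclsP/lc_brZl.
Qed.

Lemma lbrZr k u v : lbr u (k *: v) = k *: lbr u v.
Proof.
elim/lcls_ind: u => a; elim/lcls_ind: v => b.
by rewrite -lclsZ -!lcls_br -lclsZ; apply/lclsP/lc_brZr.
Qed.

Lemma lbrvv u : lbr u u = 0.
Proof. by elim/lcls_ind: u => a; rewrite -lcls_br; apply/lclsP/lc_alt. Qed.

Lemma lbr_jacobi u v w : lbr u (lbr v w) + (lbr v (lbr w u) + lbr w (lbr u v)) = 0.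
Proof.
elim/lcls_ind: u => a; elim/lcls_ind: v => b; elim/lcls_ind: w => c.
by rewrite -!lcls_br -!lclsD; apply/lclsP/lc_jacobi.
Qed.

Lemma lbrNl u v : lbr (- u) v = - lbr u v.
Proof. by rewrite -!scaleN1r lbrZl. Qed.

Lemma lbrNr u v : lbr u (- v) = - lbr u v.
Proof. by rewrite -!scaleN1r lbrZr. Qed.

Lemma lbrv0 u : lbr u 0 = 0.
Proof. by have := lbrZr 0 u 0; rewrite !scale0r. Qed.

Lemma lbr0v u : lbr 0 u = 0.
Proof. by have := lbrZl 0 0 u; rewrite !scale0r. Qed.

Lemma lbrC u v : lbr u v = - lbr v u.
Proof.
apply/eqP; rewrite -addr_eq0; apply/eqP.
by have := lbrvv (u + v); rewrite lbrDl !lbrDr !lbrvv add0r addr0.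
Qed.

Lemma lbr_der u v w : lbr u (lbr v w) = lbr (lbr u v) w + lbr v (lbr u w).
Proof.
have /eqP := lbr_jacobi u v w.
rewrite (lbrC w u) (lbrC w (lbr u v)) lbrNr -opprD subr_eq0 => /eqP->.
by rewrite addrC.
Qed.

Lemma lcls_sub a b : lcls (lsub a b) = lcls a - lcls b.
Proof. by rewrite /lsub lclsD lclsZ scaleN1r. Qed.

Lemma lcls_rel r : Rel r -> lcls r = 0.
Proof. by move=> rel_r; apply/lclsP/lc_rel. Qed.

End Presented.

(** * The operators satisfy the relations *)

Section Operators.
Variables (C : fieldType) (lam t : C).
Local Notation gen := (slgens lam t).
Local Notation ev := (lieval gen).

Lemma opx_linear : linear (opx lam).
Proof. by move=> a p q; rewrite /opx derivD derivZ -!mul_polyC; ring. Qed.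

Lemma opy_linear : linear (@opy C).
Proof. by move=> a p q; rewrite /opy derivD derivZ -!mul_polyC; ring. Qed.

Lemma opz_linear : linear (opz t).
Proof. by move=> a p q; rewrite /opz derivnD derivnZ -!mul_polyC; ring. Qed.

Lemma lieval_linear w : linear (ev w).
Proof.
elim: w => [[[|[|[|//]]] lt_i3]||u IHu v IHv|k u IHu|u IHu v IHv] a p q /=.
- exact: opx_linear.
- exact: opy_linear.
- exact: opz_linear.
- by rewrite /op0 scaler0 addr0.
- by rewrite /opD IHu IHv scalerDr addrACA.
- by rewrite /opZ IHu scalerDr !scalerA mulrC.
- by rewrite /opBr IHv !IHu IHv scalerBr opprD addrACA.
Qed.

Lemma lieval0 w : ev w 0 = 0.
Proof.
by have /= := lieval_linear w (-1) 0 0; rewrite scaler0 addr0 scaleN1r addNr.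
Qed.

Lemma lievalD w : {morph ev w : p q / p + q}.
Proof. by move=> p q; have := lieval_linear w 1 p q; rewrite !scale1r. Qed.

Lemma lievalZ w k p : ev w (k *: p) = k *: ev w p.
Proof. by have := lieval_linear w k p 0; rewrite lieval0 !addr0. Qed.

Lemma lievalN w : {morph ev w : p / - p}.
Proof. by move=> p; rewrite -!scaleN1r lievalZ. Qed.

Lemma lievalB w : {morph ev w : p q / p - q}.
Proof. by move=> p q; rewrite lievalD lievalN. Qed.

Definition oph : op C := fun p => 2 *: ('X * p^`()) - (lam - 1) *: p.

Lemma ev_h p : ev (LBr (gx C) (gy C)) p = oph p.
Proof.
rewrite /= /slgens /= /opBr /opx /opy /oph !(derivE, derivZ, derivB) -!mul_polyC.
by rewrite !polyCB /=; ring.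
Qed.

Ltac opring :=
  rewrite /opBr /opx /opy /opz /oph /opD /opZ ?derivSn ?derivn1 ?derivn0;
  rewrite ?(derivE, derivZ, derivB, derivD, derivM, derivN, derivXn, derivX);
  rewrite -?mul_polyC;
  rewrite ?(derivE, derivZ, derivB, derivD, derivM, derivN, derivXn, derivX) /=;
  ring.

Local Notation mu := (lam - 1).

(** Normal forms of [(ad x)^i z]. Computing each from the previous one keeps the identities left to
    [ring] small. *)
Definition opz1 : op C := fun p =>
  t *: (- 4 *: ('X * p^`(2)) + (2 * (mu - 1)) *: p^`()).
Definition opz2 : op C := fun p =>
  t *: (12 *: ('X ^+ 2 * p^`(2)) - (12 * (mu - 1)) *: ('X * p^`())
        + (2 * mu * (mu - 1)) *: p).
Definition opz3 : op C := fun p =>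
  t *: (- 24 *: ('X ^+ 3 * p^`(2)) + (36 * (mu - 1)) *: ('X ^+ 2 * p^`())
        - (12 * mu * (mu - 1)) *: ('X * p)).
Definition opz4 : op C := fun p =>
  t *: (24 *: ('X ^+ 4 * p^`(2)) - (48 * (mu - 1)) *: ('X ^+ 3 * p^`())
        + (24 * mu * (mu - 1)) *: ('X ^+ 2 * p)).

Lemma opBr_z1 p : opBr (opx lam) (opz t) p = opz1 p.
Proof. rewrite /opz1; opring. Qed.

Lemma opBr_z2 p : opBr (opx lam) opz1 p = opz2 p.
Proof. rewrite /opz1 /opz2; opring. Qed.

Lemma opBr_z3 p : opBr (opx lam) opz2 p = opz3 p.
Proof. rewrite /opz3 /opz2; opring. Qed.

Lemma opBr_z4 p : opBr (opx lam) opz3 p = opz4 p.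
Proof. rewrite /opz3 /opz4; opring. Qed.

Lemma opBr_z5 p : opBr (opx lam) opz4 p = 0.
Proof. rewrite /opz4; opring. Qed.

Lemma opBr_zz1 p : opBr (opz t) opz1 p = - (8 * t ^+ 2) *: p^`(3).
Proof. rewrite /opz1; opring. Qed.

Lemma opBr_zz2 p : opBr (opz t) opz2 p =
  t ^+ 2 *: (48 *: ('X * p^`(3)) - (24 * (mu - 2)) *: p^`(2)).
Proof. rewrite /opz2; opring. Qed.

Lemma op_rel21 p : 3 *: opBr opz1 opz2 p - 2 *: opBr (opz t) opz3 p =
  (24 * t ^+ 2 * (lam ^+ 2 - 4)) *: opy p.
Proof. rewrite /opz1 /opz2 /opz3; opring. Qed.

Lemma op_rel31 p : opBr (opz t) (fun p => - (8 * t ^+ 2) *: p^`(3)) p = 0.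
Proof. opring. Qed.

Lemma op_rel32 p :
  4 *: opBr opz3 (fun p => - (8 * t ^+ 2) *: p^`(3)) p -
  3 *: opBr opz2
    (fun p => t ^+ 2 *: (48 *: ('X * p^`(3)) - (24 * (mu - 2)) *: p^`(2))) p =
  (576 * t ^+ 2 * (lam ^+ 2 - 9)) *: opz t p.
Proof. rewrite /opz2 /opz3; opring. Qed.

Lemma eq_opBr (f f' g g' : op C) : f =1 f' -> g =1 g' -> opBr f g =1 opBr f' g'.
Proof. by move=> eqf eqg p; rewrite /opBr !eqf !eqg. Qed.

Let evx : ev (gx C) = opx lam. Proof. by []. Qed.
Let evy : ev (gy C) = @opy C. Proof. by []. Qed.
Let evz : ev (gz C) = opz t. Proof. by []. Qed.

Lemma ev_z1 : ev (zz C 1) =1 opz1.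
Proof. exact: opBr_z1. Qed.

Lemma ev_z2 : ev (zz C 2) =1 opz2.
Proof. by move=> p; rewrite -opBr_z2; apply: eq_opBr => // q; apply: ev_z1. Qed.

Lemma ev_z3 : ev (zz C 3) =1 opz3.
Proof. by move=> p; rewrite -opBr_z3; apply: eq_opBr => // q; apply: ev_z2. Qed.

Lemma ev_z4 : ev (zz C 4) =1 opz4.
Proof. by move=> p; rewrite -opBr_z4; apply: eq_opBr => // q; apply: ev_z3. Qed.

Lemma ev_zz1 : ev (LBr (gz C) (zz C 1)) =1 (fun p => - (8 * t ^+ 2) *: p^`(3)).
Proof. by move=> p; rewrite -opBr_zz1; apply: eq_opBr => // q; apply: ev_z1. Qed.

Lemma ev_zz2 : ev (LBr (gz C) (zz C 2)) =1
  (fun p => t ^+ 2 *: (48 *: ('X * p^`(3)) - (24 * (mu - 2)) *: p^`(2))).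
Proof. by move=> p; rewrite -opBr_zz2; apply: eq_opBr => // q; apply: ev_z2. Qed.

Lemma ev_lsub a b p : ev (lsub a b) p = ev a p - ev b p.
Proof. by rewrite /= /opD /opZ scaleN1r. Qed.

Lemma ev_rel r p : sl_rels lam t r -> ev r p = 0.
Proof.
have evBr a b q : ev (LBr a b) q = opBr (ev a) (ev b) q by [].
have evZ k a q : ev (LScale k a) q = k *: ev a q by [].
case=> [->|[->|[->|[->|[->|[->|[->|->]]]]]]].
- by rewrite ev_lsub evZ evBr (eq_opBr ev_h (fun=> erefl)) evx; opring.
- by rewrite ev_lsub evZ evBr (eq_opBr ev_h (fun=> erefl)) evy; opring.
- by rewrite evBr evy evz; opring.
- by rewrite ev_lsub evZ evBr (eq_opBr ev_h (fun=> erefl)) evz; opring.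
- by rewrite -(opBr_z5 p); apply: eq_opBr => // q; apply: ev_z4.
- rewrite !ev_lsub !evZ !evBr (eq_opBr ev_z1 ev_z2) (eq_opBr (fun=> erefl) ev_z3).
  by rewrite op_rel21 subrr.
- by rewrite evBr (eq_opBr (fun=> erefl) ev_zz1) op_rel31.
- rewrite !ev_lsub !evZ !(evBr (zz C _)) (eq_opBr ev_z3 ev_zz1) (eq_opBr ev_z2 ev_zz2).
  by rewrite op_rel32 subrr.
Qed.

(** Members of [op] are arbitrary maps, on which the commutator is not even bilinear; the Lie axioms
    hold here because every [ev w] is linear. *)
Lemma lcong_ev a b : lcong (sl_rels lam t) a b -> ev a =1 ev b.
Proof.
elim=> {a b} //=; rewrite /opD /opZ /opBr /op0.
- by move=> a b _ eq_ab p.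
- by move=> a b c _ eq_ab _ eq_bc p; rewrite eq_ab.
- by move=> a a' b b' _ eqa _ eqb p; rewrite eqa eqb.
- by move=> k a a' _ eqa p; rewrite eqa.
- by move=> a a' b b' _ eqa _ eqb p; rewrite !eqa !eqb.
- by move=> a b c p; rewrite addrA.
- by move=> a b p; rewrite addrC.
- by move=> a p; rewrite add0r.
- by move=> a p; rewrite scaleN1r subrr.
- by move=> a p; rewrite scale1r.
- by move=> k l a p; rewrite scalerA.
- by move=> k a b p; rewrite scalerDr.
- by move=> k l a p; rewrite scalerDl.
- by move=> a b c p; rewrite lievalD opprD addrACA.
- by move=> a b c p; rewrite lievalD opprD addrACA.
- by move=> k a b p; rewrite lievalZ scalerBr.
- by move=> k a b p; rewrite lievalZ scalerBr.
- by move=> a p; rewrite subrr.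
- by move=> a b c p; rewrite !lievalB; ring.
- by move=> r rel_r p; apply: ev_rel.
Qed.

End Operators.

(** * Strings of vectors under sl(2) in the presented algebra *)

Section Spanning.
Variables (C : numFieldType) (lam t : C).
Local Notation L := (lalg (sl_rels lam t)).
Local Notation br := (@lbr C (sl_rels lam t)).
Local Notation cls := (@lcls C (sl_rels lam t)).
Local Notation x := (cls (gx C)).
Local Notation y := (cls (gy C)).
Local Notation z := (cls (gz C)).
Local Notation h := (br x y).

Definition brE := (@lbrDl C (sl_rels lam t), @lbrDr C (sl_rels lam t),
  @lbrZl C (sl_rels lam t), @lbrZr C (sl_rels lam t),
  @lbrNl C (sl_rels lam t), @lbrNr C (sl_rels lam t)).

Ltac lin := lincomb (GRing.ComPzRing.clone C _).

Lemma br_hx : br h x = 2 *: x.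
Proof.
apply/eqP; rewrite -subr_eq0; apply/eqP.
by rewrite -!lcls_br -lclsZ -lcls_sub; apply: lcls_rel; left.
Qed.

Lemma br_hy : br h y = -2 *: y.
Proof.
apply/eqP; rewrite -subr_eq0; apply/eqP.
by rewrite -!lcls_br -lclsZ -lcls_sub; apply: lcls_rel; right; left.
Qed.

Lemma br_yz : br y z = 0.
Proof. by rewrite -!lcls_br; apply: lcls_rel; do 2!right; left. Qed.

Lemma br_hz : br h z = -4 *: z.
Proof.
apply/eqP; rewrite -subr_eq0; apply/eqP.
by rewrite -!lcls_br -lclsZ -lcls_sub; apply: lcls_rel; do 3!right; left.
Qed.

Lemma lcls_zzS i : cls (zz C i.+1) = br x (cls (zz C i)).
Proof. by rewrite -lcls_br. Qed.

Lemma lcls_zz5 : br x (cls (zz C 4)) = 0.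
Proof. by rewrite -lcls_br; apply: lcls_rel; do 4!right; left. Qed.

Lemma br_rel21 :
  3 *: br (cls (zz C 1)) (cls (zz C 2)) - 2 *: br z (cls (zz C 3)) =
  (24 * t ^+ 2 * (lam ^+ 2 - 4)) *: y.
Proof.
have := @lcls_rel _ (sl_rels lam t) (r21 lam t) ltac:(by do 5!right; left).
by rewrite !lcls_sub !lclsZ !lcls_br => /eqP; rewrite subr_eq0 => /eqP.
Qed.

Lemma br_rel31 : br z (br z (cls (zz C 1))) = 0.
Proof. by rewrite -!lcls_br; apply: lcls_rel; do 6!right; left. Qed.

Lemma br_rel32 :
  4 *: br (cls (zz C 3)) (br z (cls (zz C 1))) -
  3 *: br (cls (zz C 2)) (br z (cls (zz C 2))) =
  (576 * t ^+ 2 * (lam ^+ 2 - 9)) *: z.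
Proof.
have := @lcls_rel _ (sl_rels lam t) (r32 lam t) ltac:(by do 7!right).
by rewrite !lcls_sub !lclsZ !lcls_br => /eqP; rewrite subr_eq0 => /eqP.
Qed.

(** The scalar in the recursion makes [[ez 1, w_n] = 2n w_(n+1)] exact, and [w_1 = -2y] makes the
    Poisson formula exact for [n = 1]. *)
Fixpoint lvec_rec (n : nat) : L :=
  match n with
  | 0 => 0
  | 1 => -2 *: y
  | 2 => z
  | n'.+1 => (2 * n')%:R^-1 *: br (4%:R^-1 *: br x z) (lvec_rec n')
  end.

(* [lvec n] and [wvec n k] are the vectors w_n and e_(n,k) of the header.  As the
   inverse of 0 is 0, [wvec n k = 0] for [k > 2 * n]. *)
Fixpoint wvec_rec (n k : nat) : L :=
  if k is k'.+1 then (2 * n - k')%:R^-1 *: br x (wvec_rec n k') else lvec_rec n.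

(* Locked, because otherwise [rewrite] unfolds them when matching scalar multiples. *)
Definition lvec := locked lvec_rec.
Definition wvec := locked wvec_rec.
Local Notation ez := (wvec 2).

Lemma lvec0E : lvec 0 = 0. Proof. by rewrite /lvec -lock. Qed.
Lemma lvec1E : lvec 1 = -2 *: y. Proof. by rewrite /lvec -lock. Qed.
Lemma lvec2E : lvec 2 = z. Proof. by rewrite /lvec -lock. Qed.
Lemma wvec0E n : wvec n 0 = lvec n. Proof. by rewrite /wvec /lvec -!lock. Qed.
Lemma wvecSE n k : wvec n k.+1 = (2 * n - k)%:R^-1 *: br x (wvec n k).
Proof. by rewrite /wvec -lock. Qed.

Lemma natC_neq0 n : (0 < n)%N -> n%:R != 0 :> C.
Proof. by rewrite pnatr_eq0 lt0n. Qed.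

Lemma br_x_wvec n k : (k < 2 * n)%N ->
  br x (wvec n k) = (2 * n - k)%:R *: wvec n k.+1.
Proof.
by move=> lt_k; rewrite wvecSE scalerA divff ?scale1r // natC_neq0 // subn_gt0.
Qed.

Lemma wvec_top n : wvec n (2 * n).+1 = 0.
Proof. by rewrite wvecSE subnn invr0 scale0r. Qed.

Lemma ez1E : ez 1 = 4%:R^-1 *: br x z.
Proof. by rewrite wvecSE wvec0E lvec2E. Qed.

Lemma br_ez1_lvec n : (1 < n)%N -> br (ez 1) (lvec n) = (2 * n)%:R *: lvec n.+1.
Proof.
case: n => [|[|n]] // _; rewrite ez1E /lvec -!lock [lvec_rec n.+3]/=.
by rewrite scalerA divff ?scale1r // natC_neq0.
Qed.

Lemma br_hez1 : br h (ez 1) = -2 *: ez 1.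
Proof.
rewrite ez1E !brE lbr_der br_hx br_hz !brE; lin; ring.
Qed.

(** Each step of the recursion brackets with [ez 1], which has weight -2. *)
Lemma br_h_lvec n : br h (lvec n) = - (2 * n)%:R *: lvec n.
Proof.
elim: n => [|[|[|n]] IHn]; first by rewrite lvec0E lbrv0 scaler0.
- by rewrite lvec1E brE br_hy; lin; ring.
- by rewrite lvec2E br_hz; lin; ring.
have n_neq0 : (2 * n.+2)%:R != 0 :> C by rewrite natC_neq0.
apply: (scalerI n_neq0); rewrite -lbrZr -br_ez1_lvec // lbr_der br_hez1 IHn !brE.
rewrite !br_ez1_lvec //; lin; ring.
Qed.

Lemma br_h_wvec n k : br h (wvec n k) = (2 * k%:R - 2 * n%:R) *: wvec n k.
Proof.
elim: k => [|k IHk]; first by rewrite wvec0E br_h_lvec; lin; ring.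
rewrite wvecSE brE lbr_der br_hx IHk !brE; lin; ring.
Qed.

(** The usual sl(2) computation up the string, started by [[y, z] = 0]. *)
Lemma br_yez i : (i <= 4)%N -> br y (ez i) = i%:R *: ez i.-1.
Proof.
elim: i => [|i IHi] lt_i; first by rewrite wvec0E lvec2E br_yz; lin; ring.
have i_neq0 : (2 * 2 - i)%:R != 0 :> C by rewrite natC_neq0 // subn_gt0.
apply: (scalerI i_neq0); rewrite -lbrZr -br_x_wvec //.
rewrite lbr_der (lbrC y x) lbrNl br_h_wvec IHi 1?ltnW // brE.
case: i lt_i {IHi i_neq0} => [|i] lt_i; first by rewrite subn0 /=; lin; ring.
rewrite !succnK br_x_wvec 1?ltnW // !natrB; [lin; ring|lia|lia].
Qed.

Lemma zz1E : cls (zz C 1) = 4 *: ez 1.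
Proof. by rewrite lcls_zzS -lvec2E -wvec0E br_x_wvec. Qed.

Lemma zz2E : cls (zz C 2) = 12 *: ez 2.
Proof. by rewrite lcls_zzS zz1E brE br_x_wvec // -[(_ - _)%N]/3%N; lin; ring. Qed.

Lemma zz3E : cls (zz C 3) = 24 *: ez 3.
Proof. by rewrite lcls_zzS zz2E brE br_x_wvec // -[(_ - _)%N]/2%N; lin; ring. Qed.

Lemma zz4E : cls (zz C 4) = 24 *: ez 4.
Proof. by rewrite lcls_zzS zz3E brE br_x_wvec // -[(_ - _)%N]/1%N; lin; ring. Qed.

(** At the top, [i = 4], both sides vanish because of (1.3). *)
Lemma br_xez i : (i <= 4)%N -> br x (ez i) = (4 - i)%:R *: ez i.+1.
Proof.
rewrite leq_eqVlt => /predU1P[->|lt_i]; last by rewrite br_x_wvec.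
by have := lcls_zz5; rewrite zz4E brE => /eqP; rewrite scaler_eq0 pnatr_eq0 /=
  => /eqP->; rewrite scale0r.
Qed.

(** * The filtration, and the errors in the Poisson formula *)

Inductive filt (n : nat) : L -> Prop :=
  | filt_gen j k : (0 < j <= n)%N -> (k <= 2 * j)%N -> filt n (wvec j k)
  | filt0 : filt n 0
  | filtD u v : filt n u -> filt n v -> filt n (u + v)
  | filtZ a u : filt n u -> filt n (a *: u).

Lemma filtN n u : filt n u -> filt n (- u).
Proof. by rewrite -scaleN1r; apply: filtZ. Qed.

Lemma filtB n u v : filt n u -> filt n v -> filt n (u - v).
Proof. by move=> Mu Mv; apply: filtD => //; apply: filtN. Qed.

Lemma filtS m n u : (m <= n)%N -> filt m u -> filt n u.
Proof.
move=> le_mn; elim=> [j k /andP[j_gt0 le_j] le_k||v v' _ Mv _ Mv'|a v _ Mv].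
- by apply: filt_gen => //; rewrite j_gt0 (leq_trans le_j).
- exact: filt0.
- exact: filtD.
- exact: filtZ.
Qed.

Lemma filtS1 n u : filt n u -> filt n.+1 u.
Proof. exact: filtS. Qed.

Lemma filt_cancel n u v : filt n (u - v) -> filt n v -> filt n u.
Proof. by move=> Muv Mv; rewrite -(subrK v u); apply: filtD. Qed.

Lemma filtZ_inv n a u : a != 0 -> filt n (a *: u) -> filt n u.
Proof. by move=> a_neq0 /(filtZ a^-1); rewrite scalerA mulVf // scale1r. Qed.

Lemma wvec_gt j k : (2 * j < k)%N -> wvec j k = 0.
Proof.
move=> lt_k; rewrite -(subnKC lt_k); elim: (k - _)%N => [|d IHd].
  by rewrite addn0 wvec_top.
by rewrite addnS wvecSE IHd lbrv0 scaler0.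
Qed.

Lemma filt_wvec n j k : (0 < j <= n)%N -> filt n (wvec j k).
Proof.
move=> le_j; have [le_k|lt_k] := leqP k (2 * j); first exact: filt_gen.
by rewrite wvec_gt //; apply: filt0.
Qed.

(** With [bry_low], this says that modulo [filt j.-1] the string of [w_j] closes up at both ends, as
    in the sl(2)-module of dimension [2j + 1]. *)
Definition brx_top j := filt j.-1 (br x (wvec j (2 * j))).
Definition bry_low j := filt j.-1 (br y (lvec j)).
(* The failure of the Poisson bracket formula for [ez i = p^(4-i) q^i]. *)
Definition defect i j k : L :=
  br (ez i) (wvec j k) - ((2 * j * i)%:R - (4 * k)%:R) *: wvec j.+1 (i + k).-1.
Definition dstep j :=
  forall i k, (i <= 4)%N -> (k <= 2 * j)%N -> filt j (defect i j k).

Lemma filt_brx n : (forall j, 0 < j <= n -> brx_top j)%N ->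
  forall v, filt n v -> filt n (br x v).
Proof.
move=> topn v; elim=> {v} [j k le_j||u v _ Mu _ Mv|a u _ Mu].
- rewrite leq_eqVlt => /predU1P[->|lt_k].
    by apply: filtS (topn j le_j); lia.
  by rewrite br_x_wvec //; apply/filtZ/filt_wvec.
- by rewrite lbrv0; apply: filt0.
- by rewrite brE; apply: filtD.
- by rewrite brE; apply: filtZ.
Qed.

(** Only the lowest vectors need a hypothesis, since [[y, [x, v]] = [x, [y, v]] - [h, v]] carries
    the claim up the string. *)
Lemma filt_bry n : (forall j, 0 < j <= n -> brx_top j)%N ->
  (forall j, 0 < j <= n -> bry_low j)%N -> forall v, filt n v -> filt n (br y v).
Proof.
move=> topxn topyn v; elim=> {v} [j k le_j||u v _ Mu _ Mv|a u _ Mu].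
- elim: k => [_|k IHk lt_k].
    by rewrite wvec0E; apply: filtS (topyn j le_j); lia.
  apply: (@filtZ_inv _ (2 * j - k)%:R); first by rewrite natC_neq0 // subn_gt0.
  rewrite -lbrZr -br_x_wvec // lbr_der (lbrC y x) lbrNl br_h_wvec.
  apply: filtD; first by apply/filtN/filtZ/filt_wvec.
  by apply: filt_brx => //; apply: IHk; apply: ltnW.
- by rewrite lbrv0; apply: filt0.
- by rewrite brE; apply: filtD.
- by rewrite brE; apply: filtZ.
Qed.

Lemma filt_brz n i : (i <= 4)%N -> (forall j, 0 < j <= n -> dstep j)%N ->
  forall v, filt n v -> filt n.+1 (br (ez i) v).
Proof.
move=> le_i dn v; elim=> {v} [j k le_j le_k||u v _ Mu _ Mv|a u _ Mu].
- have Md : filt n.+1 (defect i j k) by apply: filtS (dn j le_j i k le_i le_k); lia.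
  by apply: filt_cancel Md _; apply/filtZ/filt_wvec; lia.
- by rewrite lbrv0; apply: filt0.
- by rewrite brE; apply: filtD.
- by rewrite brE; apply: filtZ.
Qed.

(** The Poisson bracket is sl(2)-equivariant, so [ad x] acts on the errors as on tensors. The bound
    on [i + k] keeps the subtracted vector below the top of its string, where [br_x_wvec]
    applies. *)
Lemma defect_x i j k : (i <= 4)%N -> (k < 2 * j)%N -> (i + k <= (2 * j).+2)%N ->
  br x (defect i j k) =
    (4 - i)%:R *: defect i.+1 j k + (2 * j - k)%:R *: defect i j k.+1.
Proof.
move=> le_i lt_k le_ik; rewrite /defect !brE lbr_der br_xez // br_x_wvec // !brE.
case: i k lt_k le_ik le_i => [|i] [|k] lt_k le_ik le_i.
- rewrite ?(addn0, add0n, addn1) !natrB //=; lin; ring.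
- rewrite !add0n br_x_wvec; last lia.
  rewrite ?addSn ?addnS ?add0n ?succnK !natrB //=; try lia; lin; ring.
- rewrite !addn0 succnK br_x_wvec; last lia.
  rewrite ?addSn ?addnS ?addn0 ?succnK !natrB //=; try lia; lin; ring.
- rewrite !addSn addnS !succnK br_x_wvec; last lia.
  rewrite ?addSn ?addnS ?succnK !natrB //=; try lia; lin; ring.
Qed.

(** Solves [defect_x] for its last term; at [i = 4] the other term has coefficient zero. *)
Lemma filt_defectS j i k : (forall v, filt j v -> filt j (br x v)) ->
  (i <= 4)%N -> (k < 2 * j)%N -> (i + k <= (2 * j).+2)%N ->
  filt j (defect i j k) -> ((i < 4)%N -> filt j (defect i.+1 j k)) ->
  filt j (defect i j k.+1).
Proof.
move=> Mx le_i lt_k le_ik Mik MSik.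
apply: (@filtZ_inv _ (2 * j - k)%:R); first by rewrite natC_neq0 // subn_gt0.
apply: (@filt_cancel _ _ (- ((4 - i)%:R *: defect i.+1 j k))).
  by rewrite opprK addrC -defect_x //; apply: Mx.
case: ltnP MSik => [lt_i MSik|ge_i _]; first by apply/filtN/filtZ/MSik.
by rewrite (eqP ge_i) scale0r; apply/filtN/filt0.
Qed.

(** The shift of index is deliberate, as [dstep j] controls the ends of the next string. Under
    [tame n], [ad x] and [ad y] preserve [filt n.+1], and [ad (ez i)] maps [filt n] to [filt n.+1]
    for [i <= 4]. *)
Definition tame n :=
  forall j, (0 < j <= n)%N -> [/\ dstep j, brx_top j.+1 & bry_low j.+1].

Lemma wvec11E : wvec 1 1 = - h.
Proof. by rewrite wvecSE wvec0E lvec1E brE -[(_ - _)%N]/2%N; lin; field. Qed.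

Lemma wvec12E : wvec 1 2 = 2 *: x.
Proof.
by rewrite wvecSE wvec11E brE (lbrC x) br_hx -[(_ - _)%N]/1%N; lin; field.
Qed.

Lemma brx_top1 : brx_top 1.
Proof. by rewrite /brx_top wvec12E brE lbrvv scaler0; apply: filt0. Qed.

Lemma bry_low1 : bry_low 1.
Proof. by rewrite /bry_low lvec1E brE lbrvv scaler0; apply: filt0. Qed.

Lemma tame_topx n : tame n -> (forall j, 0 < j <= n.+1 -> brx_top j)%N.
Proof. by move=> gn [|[|j]] // lt_j; [apply: brx_top1|case: (gn j.+1 lt_j)]. Qed.

Lemma tame_topy n : tame n -> (forall j, 0 < j <= n.+1 -> bry_low j)%N.
Proof. by move=> gn [|[|j]] // lt_j; [apply: bry_low1|case: (gn j.+1 lt_j)]. Qed.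

Lemma tame_brx n v : tame n -> filt n.+1 v -> filt n.+1 (br x v).
Proof. by move=> gn; apply/filt_brx/tame_topx. Qed.

Lemma tame_bry n v : tame n -> filt n.+1 v -> filt n.+1 (br y v).
Proof. by move=> gn; apply: filt_bry; [apply: tame_topx|apply: tame_topy]. Qed.

Lemma tame_brz n i v : tame n -> (i <= 4)%N -> filt n v -> filt n.+1 (br (ez i) v).
Proof. by move=> gn le_i; apply: filt_brz => // j /gn[]. Qed.

(** The errors with [k = 0] propagate to larger [k] through [defect_x]; the ends of the next string
    then follow. *)
Lemma tameS n : tame n -> (forall i, (i <= 4)%N -> filt n.+1 (defect i n.+1 0)) ->
  tame n.+1.
Proof.
move=> gn d0 j /andP[j_gt0]; rewrite leq_eqVlt => /predU1P[->|lt_j]; last first.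
  by apply: gn; rewrite j_gt0.
have Mx v : filt n.+1 v -> filt n.+1 (br x v) by apply: tame_brx.
(* This reaches every pair except [i = 4], [k = 2 * n.+1]. *)
have d_low i k : (i <= 4)%N -> (k <= 2 * n.+1)%N -> (i + k <= (2 * n.+1).+3)%N ->
    filt n.+1 (defect i n.+1 k).
  elim: k i => [|k IHk] i le_i le_k le_ik; first exact: d0.
  by apply: filt_defectS => //; [|apply: IHk|move=> ?; apply: IHk]; lia.
(* Applying [ad x] to the errors at [(3, 2 * n.+1)] and [(4, (2 * n).+1)] gives two equations in the
   missing bracket and [br x E]. Their difference is [2 * n.+1 + 4] times [br x E]. *)
set E := wvec n.+2 (2 * n.+2).
have x_top_z : filt n.+1 (br (ez 3) (br x (wvec n.+1 (2 * n.+1)))).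
  by apply: tame_brz => //; apply: (tame_topx gn (j := n.+1)); lia.
have Mdx3 : filt n.+1 (br (ez 4) (wvec n.+1 (2 * n.+1)) + (2 * n.+1%:R) *: br x E).
  have /Mx : filt n.+1 (defect 3 n.+1 (2 * n.+1)) by apply: d_low; lia.
  have -> : br x (defect 3 n.+1 (2 * n.+1)) =
      (br (ez 4) (wvec n.+1 (2 * n.+1)) + (2 * n.+1%:R) *: br x E) +
      br (ez 3) (br x (wvec n.+1 (2 * n.+1))).
    rewrite /defect !brE lbr_der br_xez // -[(4 - 3)%N]/1%N brE.
    have -> : (3 + 2 * n.+1).-1 = (2 * n.+2)%N by lia.
    by rewrite -/E; lin; ring.
  by move=> Md; have := filtB Md x_top_z; rewrite addrK.
have Mdx4 : filt n.+1 (br (ez 4) (wvec n.+1 (2 * n.+1)) - 4 *: br x E).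
  have /Mx : filt n.+1 (defect 4 n.+1 (2 * n).+1) by apply: d_low; lia.
  rewrite /defect !brE lbr_der br_xez // subnn scale0r lbr0v br_x_wvec; last lia.
  have -> : (4 + (2 * n).+1).-1 = (2 * n.+2)%N by lia.
  have -> : (2 * n).+2 = (2 * n.+1)%N by lia.
  have -> : (2 * n.+1 - (2 * n).+1)%N = 1%N by lia.
  rewrite -/E brE; congr filt; lin; ring.
have topE : filt n.+1 (br x E).
  apply: (@filtZ_inv _ (2 * n.+3)%:R); first exact: natC_neq0.
  by have := filtB Mdx3 Mdx4; congr filt; lin; ring.
split=> //.
- move=> i k le_i le_k.
  have [le_ik|lt_ik] := leqP (i + k) (2 * n.+1).+3; first exact: d_low.
  have [-> ->] : i = 4%N /\ k = (2 * n.+1)%N by lia.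
  have := filtD Mdx4 (filtZ 4 topE); congr filt.
  rewrite /defect; have -> : (2 * n.+1 * 4)%:R = (4 * (2 * n.+1))%:R :> C.
    by rewrite mulnC.
  by lin; ring.
(* The low end: [w_(n+2)] is a multiple of [[ez 1, w_(n+1)]], and [ad y] turns [ez 1] into [ez 0],
   which produces [defect 0 n.+1 0]. For [n = 0] it is (1.1). *)
- clear d_low E x_top_z Mdx3 Mdx4 topE.
  rewrite /bry_low; case: n => [|n] in gn d0 Mx *.
    by rewrite lvec2E br_yz; apply: filt0.
  apply: (@filtZ_inv _ (2 * n.+2)%:R); first exact: natC_neq0.
  rewrite -lbrZr -br_ez1_lvec // lbr_der br_yez // scale1r.
  have := d0 0%N isT; rewrite /defect !muln0 subrr scale0r subr0 => d00.
  rewrite -[lvec n.+2]wvec0E; apply: filtD => //; apply: tame_brz => //.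
  by rewrite wvec0E; apply: (tame_topy gn (j := n.+2)); lia.
Qed.

(** * Relations (2.1) and (3.1) on the strings *)

Lemma ez_rel21 : 3 *: br (ez 1) (ez 2) - br (ez 0) (ez 3) =
  (24 * t ^+ 2 * (lam ^+ 2 - 4) / 48) *: y.
Proof.
have n48 : 48 != 0 :> C by rewrite pnatr_eq0.
apply: (scalerI n48); rewrite scalerA mulrC mulfVK // -br_rel21.
by rewrite zz1E zz2E zz3E !brE wvec0E lvec2E; lin; ring.
Qed.

Lemma ez_rel31 : br (ez 0) (br (ez 0) (ez 1)) = 0.
Proof.
have := br_rel31; rewrite zz1E -lvec2E -wvec0E !brE => /eqP.
by rewrite scaler_eq0 pnatr_eq0 => /eqP.
Qed.

(* The relation (2.1) applied to [wvec n k]; the leading terms cancel. *)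
Lemma defect_rel21 n k : tame n -> (0 < n)%N -> (k <= 2 * n)%N ->
  filt n.+1 (3 *: ((4 * n%:R - 4 * k%:R) *: defect 1 n.+1 k.+1 -
                (2 * n%:R - 4 * k%:R) *: defect 2 n.+1 k)
          - (6 * n%:R - 4 * k%:R) *: defect 0 n.+1 k.+2
          - (4 * k%:R) *: defect 3 n.+1 k.-1).
Proof.
move=> gn n_gt0 le_k.
have Md i : (i <= 4)%N -> filt n (defect i n k).
  by move=> le_i; have [|d _ _] := gn n; [rewrite n_gt0 /=|apply: d].
have Mzd i j : (i <= 4)%N -> (j <= 4)%N -> filt n.+1 (br (ez i) (defect j n k)).
  by move=> le_i le_j; apply: tame_brz => //; apply: Md.
pose cst := 24 * t ^+ 2 * (lam ^+ 2 - 4) / 48.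
have M12 : filt n.+1 (br (ez 1) (defect 2 n k)) by apply: Mzd.
have M21 : filt n.+1 (br (ez 2) (defect 1 n k)) by apply: Mzd.
have M03 : filt n.+1 (br (ez 0) (defect 3 n k)) by apply: Mzd.
have M30 : filt n.+1 (br (ez 3) (defect 0 n k)) by apply: Mzd.
have My : filt n.+1 (br y (wvec n k)) by apply: tame_bry => //; apply: filt_wvec; lia.
have rel_e : cst *: br y (wvec n k) =
    3 *: (br (ez 1) (br (ez 2) (wvec n k)) - br (ez 2) (br (ez 1) (wvec n k))) -
    (br (ez 0) (br (ez 3) (wvec n k)) - br (ez 3) (br (ez 0) (wvec n k))).
  have brK i j v : br (ez i) (br (ez j) v) - br (ez j) (br (ez i) v) =
      br (br (ez i) (ez j)) v by rewrite lbr_der addrK.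
  by rewrite !brK -(lbrZl cst) -ez_rel21 !brE.
have := filtB (filtZ cst My) (filtB (filtZ 3 (filtB M12 M21)) (filtB M03 M30)).
congr filt; rewrite rel_e /defect !brE.
(* At [k = 0] the truncated index [k.-1] comes with coefficient zero. *)
case: k {le_k Md Mzd My rel_e M12 M21 M03 M30} => [|k].
  rewrite !(addn0, add0n, addSn, succnK) [0.-1]/=; lin; ring.
rewrite !(add0n, addSn, succnK); lin; ring.
Qed.

Lemma defect1 n : (1 < n)%N -> defect 1 n 0 = 0.
Proof. by move=> n_gt1; rewrite /defect !wvec0E br_ez1_lvec //; lin; ring. Qed.

(** * The generic induction step, by elimination *)

Section Step.
Variable n : nat.
Hypotheses (gn : tame n) (n_gt1 : (1 < n)%N).
Hypothesis d0 : filt n.+1 (defect 0 n.+1 0).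
Local Notation D i k := (defect i n.+1 k).

Let d1 : filt n.+1 (D 1 0).
Proof. by rewrite defect1 ?ltnS 1?ltnW //; apply: filt0. Qed.

Let M_dx i k : (i <= 4)%N -> (k < 2 * n.+1)%N -> (i + k <= (2 * n.+1).+2)%N ->
  filt n.+1 (D i k) ->
  filt n.+1 ((4 - i%:R) *: D i.+1 k + (2 * n%:R + 2 - k%:R) *: D i k.+1).
Proof.
move=> le_i lt_k le_ik Md; have := tame_brx gn Md; rewrite defect_x //.
by rewrite !natrB ?(ltnW lt_k) //; congr filt; lin; ring.
Qed.

Let M_dS i k : (i <= 4)%N -> (k < 2 * n.+1)%N -> (i + k <= (2 * n.+1).+2)%N ->
  filt n.+1 (D i k) -> ((i < 4)%N -> filt n.+1 (D i.+1 k)) -> filt n.+1 (D i k.+1).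
Proof. by apply: filt_defectS => v; apply: tame_brx. Qed.

Let d01 : filt n.+1 (D 0 1).
Proof. by apply: M_dS. Qed.

(** Three unknowns with [i + k = 2]: two equations come from [ad x], one from (2.1). Eliminating
    [D 0 2] and [D 1 1] leaves a coefficient that is nonzero for [n > 0]. *)
Let d2 : filt n.+1 (D 2 0).
Proof.
have E1 := @M_dx 1 0 isT ltac:(lia) ltac:(lia) d1.
have E2 := @M_dx 0 1 isT ltac:(lia) ltac:(lia) d01.
have R := defect_rel21 gn (ltnW n_gt1) (leq0n _).
apply: (@filtZ_inv _ (- (6 * n * (2 * n + 4) * (2 * n + 5))%:R)).
  by rewrite oppr_eq0 natC_neq0 //; lia.
have := filtB (filtD (filtZ ((2 * n%:R + 2) * (2 * n%:R + 1)) R)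
               (filtZ (6 * n%:R * (2 * n%:R + 2)) E2))
           (filtZ (12 * n%:R * (2 * n%:R + 3)) E1).
congr filt; rewrite [0.-1]/=; lin; ring.
Qed.

Let d11 : filt n.+1 (D 1 1).
Proof. by apply: M_dS; lia || move=> *; assumption. Qed.

Let d02 : filt n.+1 (D 0 2).
Proof. by apply: M_dS; lia || move=> *; assumption. Qed.

(** Four unknowns with [i + k = 3]. The determinant contains [n - 2], so at [n = 2] the hypothesis
    replaces (2.1). This is the case [n = 3] of the header, since the errors here belong to
    [n.+1]. *)
Let d3 : (n = 2%N -> filt n.+1 (4 *: D 3 0 - 9 *: D 2 1)) -> filt n.+1 (D 3 0).
Proof.
move=> d3_2; have E1 := @M_dx 2 0 isT ltac:(lia) ltac:(lia) d2.
have [n_eq2|n_neq2] := eqVneq n 2%N.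
  apply: (@filtZ_inv _ 42); first by rewrite pnatr_eq0.
  have := filtD (filtZ 6 (d3_2 n_eq2)) (filtZ 9 E1).
  by rewrite n_eq2; congr filt; lin; ring.
have E2 := @M_dx 1 1 isT ltac:(lia) ltac:(lia) d11.
have E3 := @M_dx 0 2 isT ltac:(lia) ltac:(lia) d02.
have R := defect_rel21 (k := 1) gn (ltnW n_gt1) ltac:(lia).
apply: (@filtZ_inv _ (8 * (2 * n + 3) * (n - 2) * (n + 2))%:R).
  by rewrite natC_neq0 //; lia.
(* [a] is the coefficient of [D 1 2] once [D 0 3] is eliminated, and [b] that of [D 2 1] once
   [D 1 2] is eliminated too. *)
pose a : C := 24 * n%:R ^+ 2 - 16.
pose b := - 3 * (2 * n%:R - 4) * (2 * n%:R) * (2 * n%:R + 1) - 3 * a.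
have := filtB (filtZ (2 * n%:R + 2) (filtB (filtZ (2 * n%:R + 1)
  (filtD (filtZ (2 * n%:R) R) (filtZ (6 * n%:R - 4) E3))) (filtZ a E2))) (filtZ b E1).
rewrite !natrM natrB //; congr filt; rewrite [1.-1]/= /b /a; lin; ring.
Qed.

(** The same elimination for [i + k = 4], where the determinant never vanishes. *)
Let d4 : filt n.+1 (D 3 0) -> filt n.+1 (D 4 0).
Proof.
move=> M3; have d21 : filt n.+1 (D 2 1) by apply: M_dS; lia || move=> *; assumption.
have d12 : filt n.+1 (D 1 2) by apply: M_dS; lia || move=> *; assumption.
have d03 : filt n.+1 (D 0 3) by apply: M_dS; lia || move=> *; assumption.
have E1 := @M_dx 3 0 isT ltac:(lia) ltac:(lia) M3.
have E2 := @M_dx 2 1 isT ltac:(lia) ltac:(lia) d21.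
have E3 := @M_dx 1 2 isT ltac:(lia) ltac:(lia) d12.
have E4 := @M_dx 0 3 isT ltac:(lia) ltac:(lia) d03.
have R := defect_rel21 (k := 2) gn (ltnW n_gt1) ltac:(lia).
apply: (@filtZ_inv _ (2 * (2 * n + 2) * (2 * n + 3) * (2 * n + 4))%:R).
  by rewrite natC_neq0 //; lia.
pose p : C := 2 * n%:R.
pose a := 6 * p ^+ 2 - 18 * p - 8.
pose b := - 3 * (p - 8) * (p - 1) * p - 3 * a.
pose c := - 8 * (p - 1) * p * (p + 1) - 2 * b.
have := filtB (filtZ (p + 2) (filtB (filtZ (p + 1) (filtB (filtZ p
  (filtD (filtZ (p - 1) R) (filtZ (3 * p - 8) E4))) (filtZ a E3)))
  (filtZ b E2))) (filtZ c E1).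
congr filt; rewrite [2.-1]/= /c /b /a /p; lin; ring.
Qed.

Lemma tame_step : (n = 2%N -> filt n.+1 (4 *: D 3 0 - 9 *: D 2 1)) -> tame n.+1.
Proof.
move=> /d3 M3; apply: tameS => // [] [|[|[|[|[|//]]]]] // _; exact: d4.
Qed.

End Step.

(* The relation (3.1) applied to [wvec n 1]. *)
Lemma defect0 n : tame n.+1 -> (0 < n)%N -> filt n.+2 (defect 0 n.+2 0).
Proof.
move=> gn n_gt0.
have ds : dstep n by case: (gn n) => //; rewrite n_gt0 /=.
have dSs : dstep n.+1 by case: (gn n.+1) => //; rewrite ltnS leqnn.
have gn' : tame n by move=> j /andP[j_gt0 le_j]; apply: gn; rewrite j_gt0 leqW.
have brz i v : (i <= 4)%N -> filt n.+1 v -> filt n.+2 (br (ez i) v).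
  by move=> le_i; apply: tame_brz.
have brzz i j v : (i <= 4)%N -> (j <= 4)%N -> filt n v ->
    filt n.+2 (br (ez i) (br (ez j) v)).
  by move=> le_i le_j Mv; apply: brz => //; apply: tame_brz.
have rel v : br (ez 0) (br (ez 0) (br (ez 1) v)) -
    2 *: br (ez 0) (br (ez 1) (br (ez 0) v)) + br (ez 1) (br (ez 0) (br (ez 0) v)) = 0.
  have := congr1 (fun u => br u v) ez_rel31; rewrite lbr0v => <-.
  have brK u u' v' : br (br u u') v' = br u (br u' v') - br u' (br u v').
    by rewrite lbr_der addrK.
  by rewrite !brK !brE; lin; ring.
have M1 : filt n.+2 (br (ez 0) (br (ez 0) (defect 1 n 1))).
  by apply: brzz => //; apply: ds => //; lia.
have M2 : filt n.+2 (br (ez 0) (br (ez 1) (defect 0 n 1))).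
  by apply: brzz => //; apply: ds => //; lia.
have M3 : filt n.+2 (br (ez 1) (br (ez 0) (defect 0 n 1))).
  by apply: brzz => //; apply: ds => //; lia.
have M4 : filt n.+2 (br (ez 0) (defect 0 n.+1 1)) by apply: brz => //; apply: dSs.
have M5 : filt n.+2 (br (ez 0) (defect 1 n.+1 0)) by apply: brz => //; apply: dSs.
have M6 : filt n.+2 (br (ez 1) (defect 0 n.+1 0)) by apply: brz => //; apply: dSs.
(* The double brackets on the string of [w_(n+1)] cancel. [M4] and [M5] leave
   [-4 (2n - 4) + 16 (n + 1)] times [br (ez 0) (wvec n.+2 0)], which is [defect 0 n.+2 0]. *)
apply: (@filtZ_inv _ (8 * (n + 4))%:R); first by rewrite natC_neq0 //; lia.
have := filtB (filtD (filtB (filtD (filtD (filtZ (-1) M1) (filtZ 2 M2)) (filtZ (-1) M3))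
  (filtZ (2 * n%:R - 4) M4)) (filtZ (-8) M5)) (filtZ (-4) M6).
congr filt; have := rel (wvec n 1).
rewrite /defect !brE !(addn0, add0n, addSn, succnK) [0.-1]/=.
set u := br (ez 0) (br (ez 0) (br (ez 1) _)) => /eqP.
rewrite -addrA addr_eq0 => /eqP->.
lin; ring.
Qed.

(** * Base cases of the induction, and its conclusion *)

Lemma tame0 : tame 0.
Proof. by case. Qed.

Lemma tame1 : tame 1.
Proof.
apply: tameS tame0 _ => i le_i.
rewrite /defect wvec0E lvec1E brE lbrC br_yez // addn0.
set u := _ - _; have -> : u = 0; last exact: filt0.
by rewrite /u; lin; ring.
Qed.

(** Here both arguments lie in the string of [z], so the diagonal errors vanish by antisymmetry.
    With [ad x] this settles [i + k] equal to 0, 2 and, after 3, also 4. For 3, antisymmetry turns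
    (2.1) itself into an equation between errors modulo [y]. *)
Lemma tame2 : tame 2.
Proof.
have My : filt 2 y.
  have -> : y = (-2)^-1 *: lvec 1 by rewrite lvec1E; lin; field.
  by rewrite -wvec0E; apply/filtZ/filt_wvec.
have dx i k : (i <= 4)%N -> (k <= 4)%N -> (i + k <= 6)%N -> (k < 4)%N ->
    filt 2 (defect i 2 k) ->
  filt 2 ((4 - i%:R) *: defect i.+1 2 k + (4 - k%:R) *: defect i 2 k.+1).
  move=> le_i le_k le_ik lt_k Md; have := tame_brx tame1 Md.
  by rewrite defect_x // !natrB.
have diag i : filt 2 (defect i 2 i).
  rewrite /defect lbrvv; have -> : (2 * 2 * i = 4 * i)%N by lia.
  by rewrite subrr scale0r subr0; apply: filt0.
have d10 : filt 2 (defect 1 2 0) by rewrite defect1 //; apply: filt0.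
have d20 : filt 2 (defect 2 2 0).
  apply: (@filtZ_inv _ 3); first by rewrite pnatr_eq0.
  have := filtB (dx 1%N 0%N isT isT isT isT d10) (filtZ 4 (diag 1%N)).
  by congr filt; lin; ring.
have d12E : 3 *: defect 1 2 2 + defect 3 2 0 =
    (24 * t ^+ 2 * (lam ^+ 2 - 4) / 48) *: y.
  rewrite -ez_rel21 /defect (lbrC (ez 3)) !(addn0, add0n, addSn, succnK).
  by lin; ring.
have d21E : defect 2 2 1 = - defect 1 2 2.
  rewrite /defect (lbrC (ez 2)) !(addn0, add0n, addSn, succnK).
  by lin; ring.
have d30 : filt 2 (defect 3 2 0).
  apply: (@filtZ_inv _ 10); first by rewrite pnatr_eq0.
  have := filtD (filtZ 3 (dx 2%N 0%N isT isT isT isT d20))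
    (filtZ (4 * (24 * t ^+ 2 * (lam ^+ 2 - 4) / 48)) My).
  by rewrite d21E -scalerA -d12E; congr filt; lin; ring.
have d21 : filt 2 (defect 2 2 1).
  apply: (@filtZ_inv _ 4); first by rewrite pnatr_eq0.
  have := filtB (dx 2%N 0%N isT isT isT isT d20) (filtZ 2 d30).
  by congr filt; lin; ring.
have d31 : filt 2 (defect 3 2 1).
  apply: (@filtZ_inv _ 2); first by rewrite pnatr_eq0.
  have := filtB (dx 2%N 1%N isT isT isT isT d21) (filtZ 3 (diag 2%N)).
  by congr filt; lin; ring.
have d40 : filt 2 (defect 4 2 0).
  have := filtB (dx 3%N 0%N isT isT isT isT d30) (filtZ 4 d31).
  by congr filt; lin; ring.
by apply: tameS tame1 _ => -[|[|[|[|[|//]]]]] // _; apply: diag.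
Qed.

(** By (3.1), [z] commutes with [w_3], a multiple of [[z, ez 1]]; (3.2) supplies the equation
    missing in the exceptional case. *)
Lemma tame3 : tame 3.
Proof.
apply: tame_step tame2 isT _ _ => [|_].
  rewrite /defect !muln0 subrr scale0r subr0 [wvec 3 0]wvec0E.
  have -> : lvec 3%N = - 4^-1 *: br (ez 0) (ez 1).
    by rewrite (lbrC (ez 0)) wvec0E br_ez1_lvec //; lin; field.
  by rewrite brE ez_rel31 scaler0; apply: filt0.
(* Rescaling the [z_i] to [ez i] gives [384 = 4 * 24 * 4] in the first bracket of (3.2) and
   [432 = 3 * 12 ^ 2] in the second. *)
have n384 : 384 != 0 :> C by rewrite pnatr_eq0.
have Md : filt 3 (br (ez 2) (defect 2 2 0)).
  by apply: tame_brz tame2 _ _ => //; case: (@tame2 2%N isT) => d _ _; apply: d.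
have Mz : filt 3 z by rewrite -lvec2E -wvec0E; apply: filt_wvec.
apply: (filtZ_inv n384).
have := filtB (filtZ 432 Md) (filtZ (576 * t ^+ 2 * (lam ^+ 2 - 9)) Mz); congr filt.
rewrite -br_rel32 zz1E zz2E zz3E -lvec2E -wvec0E !brE !(lbrC (ez 0)).
rewrite /defect !wvec0E br_ez1_lvec // !brE; rewrite !(addn0, add0n, addSn, succnK).
lin; ring.
Qed.

Lemma tame_all n : tame n.
Proof.
elim: n => [|[|[|[|n]]] IHn]; [exact: tame0|exact: tame1|exact: tame2|exact: tame3|].
by apply: tame_step => //; apply: defect0.
Qed.

(** * The strings span the presented algebra *)

Definition spanned v := exists n, filt n v.

Lemma spannedD u v : spanned u -> spanned v -> spanned (u + v).
Proof.
move=> [m Mu] [n Mv]; exists (maxn m n).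
by apply: filtD; [apply: filtS Mu; apply: leq_maxl|apply: filtS Mv; apply: leq_maxr].
Qed.

Lemma spannedZ a u : spanned u -> spanned (a *: u).
Proof. by move=> [n Mu]; exists n; apply: filtZ. Qed.

Lemma lalg_spanned v : spanned v.
Proof.
(* Stability under [ad] of the class is carried through the induction on terms; for brackets it
   follows from the Jacobi identity. *)
suff H a : spanned (cls a) /\ (forall u, spanned u -> spanned (br (cls a) u)).
  by elim/lcls_ind: v => a; case: (H a).
elim: a => [i||a [IHa IHa'] b [IHb IHb']|k a [IHa IHa']|a [IHa IHa'] b [IHb IHb']].
- case: i => -[|[|[|//]]] lt_i3.
  + have -> : LGen (Ordinal lt_i3) = gx C by congr LGen; apply: val_inj.
    split=> [|u [n Mu]]; last first.
      by exists n.+1; apply: (tame_brx (@tame_all n) (filtS1 Mu)).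
    exists 1%N; have -> : x = 2^-1 *: wvec 1 2 by rewrite wvec12E; lin; field.
    by apply/filtZ/filt_wvec.
  + have -> : LGen (Ordinal lt_i3) = gy C by congr LGen; apply: val_inj.
    split=> [|u [n Mu]]; last first.
      by exists n.+1; apply: (tame_bry (@tame_all n) (filtS1 Mu)).
    exists 1%N; have -> : y = (-2)^-1 *: wvec 1 0 by rewrite wvec0E lvec1E; lin; field.
    by apply/filtZ/filt_wvec.
  have -> : LGen (Ordinal lt_i3) = gz C by congr LGen; apply: val_inj.
  rewrite -lvec2E -wvec0E; split=> [|u [n Mu]]; first by exists 2%N; apply: filt_wvec.
  by exists n.+1; apply: (tame_brz (@tame_all n) _ Mu).
- by split=> [|u _]; [exists 0%N; apply: filt0|rewrite lbr0v; exists 0%N; apply: filt0].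
- rewrite lclsD; split=> [|u Su]; first exact: spannedD.
  by rewrite brE; apply: spannedD; [apply: IHa'|apply: IHb'].
- rewrite lclsZ; split=> [|u Su]; first exact: spannedZ.
  by rewrite brE; apply/spannedZ/IHa'.
- rewrite lcls_br; split=> [|u Su]; first exact: IHa'.
  have -> : br (br (cls a) (cls b)) u =
      br (cls a) (br (cls b) u) + (-1) *: br (cls b) (br (cls a) u).
    by rewrite scaleN1r (lbr_der (cls a)) addrK.
  by apply: spannedD; [apply/IHa'/IHb'|apply/spannedZ/IHb'/IHa'].
Qed.

End Spanning.

(** * Leading symbols of operators *)

Lemma derivn_mulX (F : fieldType) n (p : {poly F}) :
  ('X * p)^`(n.+1) = 'X * p^`(n.+1) + n.+1%:R *: p^`(n).
Proof.
elim: n => [|n IHn]; first by rewrite !derivn1 derivn0 derivM derivX -mul_polyC; ring.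
by rewrite derivnS IHn derivD derivM derivX derivZ -!derivnS -!mul_polyC; ring.
Qed.

Section Symbols.
Variable C : numFieldType.
Implicit Types (f g : op C) (P Q : {poly C}).

(** Sends [P D^n] to [n P D^(n-1)] plus lower terms, so its iterates detect the leading coefficient
    without a normal form. *)
Definition opdelta f : op C := fun p => f ('X * p) - 'X * f p.

(* For additive [f], [symb n f P] says that [f = P D^n + terms of lower order]. *)
Fixpoint symb n f P : Prop :=
  if n is n'.+1 then symb n' (opdelta f) (n%:R *: P) else forall p, f p = P * p.

Lemma eq_symb n f g P : f =1 g -> symb n f P -> symb n g P.
Proof.
elim: n f g P => /= [|n IHn] f g P eq_fg; first by move=> sf p; rewrite -eq_fg.
by apply: IHn => p; rewrite /opdelta !eq_fg.
Qed.

Lemma symbD n f g P Q : symb n f P -> symb n g Q -> symb n (opD f g) (P + Q).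
Proof.
elim: n f g P Q => /= [|n IHn] f g P Q sf sg.
  by move=> p; rewrite /opD sf sg mulrDl.
rewrite scalerDr; apply: eq_symb (IHn _ _ _ _ sf sg) => p.
by rewrite /opdelta /opD; ring.
Qed.

Lemma symbZ n a f P : symb n f P -> symb n (opZ a f) (a *: P).
Proof.
elim: n f P => /= [|n IHn] f P sf; first by move=> p; rewrite /opZ sf scalerAl.
rewrite scalerA mulrC -scalerA; apply: eq_symb (IHn _ _ sf) => p.
by rewrite /opdelta /opZ scalerBr scalerAr.
Qed.

Lemma symb_mulX n f P : symb n f P -> symb n (fun p => 'X * f p) ('X * P).
Proof.
elim: n f P => /= [|n IHn] f P sf; first by move=> p; rewrite sf mulrA.
rewrite scalerAr; apply: eq_symb (IHn _ _ sf) => p.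
by rewrite /opdelta; ring.
Qed.

Lemma symbS n f P : symb n f P -> symb n.+1 f 0.
Proof.
elim: n f P => [|n IHn] f P sf; last by have := IHn _ _ sf; rewrite /= !scaler0.
by move=> p; rewrite scaler0 /opdelta !sf; ring.
Qed.

Lemma symb0 n f : (forall p, f p = 0) -> symb n f 0.
Proof.
elim: n f => [|n IHn] f f0; first by move=> p; rewrite f0 mul0r.
by rewrite /= scaler0; apply: IHn => p; rewrite /opdelta !f0 mulr0 subrr.
Qed.

(** The iterated commutators multiply the symbol by [n!], invertible in characteristic 0. *)
Lemma symb_eq0 n f P : (forall p, f p = 0) -> symb n f P -> P = 0.
Proof.
elim: n f P => /= [|n IHn] f P f0 sf; first by have := sf 1; rewrite f0 mulr1.
have d0 p : opdelta f p = 0 by rewrite /opdelta !f0 mulr0 subrr.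
by have /eqP := IHn _ _ d0 sf; rewrite scaler_eq0 pnatr_eq0 => /eqP.
Qed.

(** The symbol of a commutator is a Poisson bracket, here of [u^2 p] and [P p^n]. In the induction,
    [opdelta] of [[x, f]] is [[x, opdelta f] - 2 u (opdelta f) - opdelta (opdelta f)], whose last
    term has too low an order to contribute. *)
Lemma symb_brx lam n f P : {morph f : p q / p + q} -> symb n f P ->
  symb n (opBr (opx lam) f) ('X ^+ 2 * P^`() - (2 * n)%:R *: ('X * P)).
Proof.
elim: n f P => [|n IHn] f P fD sf.
  by move=> p; rewrite /opBr /opx !sf derivM muln0 -!mul_polyC; ring.
have dD : {morph opdelta f : p q / p + q}.
  by move=> p q; rewrite /opdelta mulrDr !fD; ring.
have s1 := IHn _ _ dD sf.
have s2 := symb_mulX (sf : symb n (opdelta f) _).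
have s3 : symb n (opdelta (opdelta f)) (n.+1%:R *: (n.+2%:R *: 0)) := symbS sf.
rewrite /=; have -> : n.+1%:R *: ('X ^+ 2 * P^`() - (2 * n.+1)%:R *: ('X * P)) =
    ('X ^+ 2 * (n.+1%:R *: P)^`() - (2 * n)%:R *: ('X * (n.+1%:R *: P))) +
    (-2 *: ('X * (n.+1%:R *: P)) + (-1) *: (n.+1%:R *: (n.+2%:R *: 0))).
  by rewrite !scaler0 derivZ -!mul_polyC; ring.
apply: eq_symb (symbD s1 (symbD (symbZ (-2) s2) (symbZ (-1) s3))) => p.
have opxX q : opx lam ('X * q) = 'X * opx lam q + 'X * ('X * q).
  by rewrite /opx derivM derivX -!mul_polyC; ring.
have opxB q q' : opx lam (q - q') = opx lam q - opx lam q'.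
  by rewrite /opx derivB -!mul_polyC; ring.
by rewrite /opD /opZ /opBr /opdelta opxB !opxX (fD ('X * opx lam p)) -!mul_polyC; ring.
Qed.

Lemma symb_derivn n : symb n (fun p => p^`(n)) 1.
Proof.
elim: n => [|n IHn]; first by move=> p; rewrite mul1r.
apply: (@eq_symb n _ (opdelta _) _ _ (symbZ n.+1%:R IHn)) => p.
by rewrite /opdelta /opZ derivn_mulX addrAC subrr add0r.
Qed.

End Symbols.

(** * Faithfulness of the action on polynomials *)

Section Faithful.
Variables (C : numFieldType) (lam t : C).
Ltac lin := lincomb (GRing.ComPzRing.clone C _).
Hypothesis t_neq0 : t != 0.
Local Notation L := (lalg (sl_rels lam t)).
Local Notation br := (@lbr C (sl_rels lam t)).
Local Notation cls := (@lcls C (sl_rels lam t)).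
Local Notation wvec := (wvec lam t).
Local Notation lvec := (lvec lam t).
Local Notation filt := (@filt C lam t).

Definition opval (v : L) : op C := lieval (slgens lam t) (lrep v).

Lemma opval_cls a p : opval (cls a) p = lieval (slgens lam t) a p.
Proof. by apply: lcong_ev; apply: lrep_cls. Qed.

Lemma opvalD u v p : opval (u + v) p = opD (opval u) (opval v) p.
Proof. by rewrite -(lrepK u) -(lrepK v) -lclsD opval_cls /opD !opval_cls. Qed.

Lemma opvalZ a u p : opval (a *: u) p = opZ a (opval u) p.
Proof. by rewrite -(lrepK u) -lclsZ opval_cls /opZ !opval_cls. Qed.

Lemma opval_br u v p : opval (br u v) p = opBr (opval u) (opval v) p.
Proof.
rewrite -(lrepK u) -(lrepK v) -lcls_br opval_cls.
by apply: eq_opBr => q; rewrite opval_cls.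
Qed.

Lemma opval0 p : opval 0 p = 0.
Proof. by rewrite -(scale0r 0) opvalZ /opZ scale0r. Qed.

(** Up to a multiple of [D], which commutes with [D^n], [ez 1] acts as [-t u D^2], and
    [[-t u D^2, a D^n] = n t a D^(n+1)]. *)
Lemma opval_lvec n : (0 < n)%N ->
  exists2 a, a != 0 & forall p, opval (lvec n) p = a *: p^`(n).
Proof.
elim: n => [|[|[|n]] IHn] // _.
- exists 2; first by rewrite pnatr_eq0.
  move=> p; rewrite lvec1E opvalZ /opZ opval_cls /= /slgens /= /opy.
  by rewrite scalerN scaleNr opprK.
- by exists t => // p; rewrite lvec2E opval_cls.
have [a a_neq0 IHw] := IHn isT.
have n_neq0 : (2 * n.+2)%:R != 0 :> C by rewrite natC_neq0.
(* The recursion turns [a] into [t a / 2]; writing [a = b * 2] avoids the division. *)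
have [b aE] : exists b, a = b * 2 by exists (a / 2); rewrite divfK ?pnatr_eq0.
exists (t * b).
  by move: a_neq0; rewrite aE !mulf_eq0 negb_or => /andP[/negPf-> _]; rewrite orbF.
move=> p; apply: (scalerI n_neq0); rewrite -[LHS]opvalZ -br_ez1_lvec // opval_br.
have ez1v q : 4 *: opval (wvec 2 1) q = opz1 lam t q.
  rewrite ez1E opvalZ /opZ scalerA mulfV ?pnatr_eq0 // scale1r.
  by rewrite -(@lcls_br _ (sl_rels lam t) (gx C)) opval_cls (ev_z1 lam t).
have four_neq0 : 4 != 0 :> C by rewrite pnatr_eq0.
have dd m k q : q^`(m)^`(k) = q^`(k + m) :> {poly C} by rewrite /derivn iterD.
apply: (scalerI four_neq0); rewrite /opBr scalerBr ez1v !IHw.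
rewrite [4 *: (a *: _)]scalerA [4 * a]mulrC -[(a * 4) *: _]scalerA.
rewrite -[4 *: _^`(_)]derivnZ ez1v /opz1 aE.
rewrite derivZ -derivnS !(derivnZ, derivnD) derivn_mulX -[(p^`())^`(_)]derivSn !dd.
rewrite !(add2n, addn2) -!mul_polyC; ring.
Qed.

Lemma opval_lin v : {morph opval v : p q / p + q}.
Proof. exact: lievalD. Qed.

(** By [symb_brx], [u^k] goes to [-(2n - k) u^(k+1)]; the normalisation of [wvec] cancels [2n - k],
    so [a] is the same for all [k]. *)
Lemma symb_wvec n : (0 < n)%N -> exists2 a, a != 0 & forall k, (k <= 2 * n)%N ->
  symb n (opval (wvec n k)) (a *: ((-1) ^+ k *: 'X^k)).
Proof.
move=> n_gt0; have [a a_neq0 wv] := opval_lvec n_gt0; exists a => //.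
elim=> [|k IHk] lt_k.
  rewrite !expr0 scale1r; apply: eq_symb (symbZ a (symb_derivn C n)) => p.
  by rewrite wvec0E wv.
have nk_neq0 : (2 * n - k)%:R != 0 :> C by rewrite natC_neq0 // subn_gt0.
pose P i : {poly C} := a *: ((-1) ^+ i *: 'X^i).
rewrite -[a *: _]/(P k.+1).
have -> : P k.+1 =
    (2 * n - k)%:R^-1 *: ('X ^+ 2 * (P k)^`() - (2 * n)%:R *: ('X * P k)).
  rewrite /P; apply: (scalerI nk_neq0); rewrite [RHS]scalerA mulfV // scale1r.
  rewrite !derivZ derivXn natrB 1?ltnW //.
  case: k {IHk lt_k nk_neq0} => [|k] /=; first by rewrite -!mul_polyC; ring.
  by rewrite !exprS -!mul_polyC; ring.
have sx := symbZ (2 * n - k)%:R^-1 (symb_brx lam (@opval_lin _) (IHk (ltnW lt_k))).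
apply: eq_symb sx => p; rewrite wvecSE opvalZ /opZ opval_br /opBr.
by rewrite !opval_cls.
Qed.

Lemma filt_symb0 n v : filt n v -> symb n.+1 (opval v) 0.
Proof.
elim=> {v} [j k /andP[j_gt0 le_j] le_k||u v _ su _ sv|a u _ su].
- have [a _ /(_ k le_k) sj] := symb_wvec j_gt0.
  rewrite -(subnK le_j) addnC -addnS.
  elim: (n - j)%N => [|d IHd]; first by rewrite addn1; apply: symbS sj.
  by rewrite addnS; apply: symbS IHd.
- exact/symb0/opval0.
- by rewrite -(addr0 0); apply: eq_symb (symbD su sv) => p; rewrite opvalD.
- by rewrite -(scaler0 _ a); apply: eq_symb (symbZ a su) => p; rewrite opvalZ.
Qed.

Lemma filt_decomp n v : filt n.+1 v -> exists (c : nat -> C) u,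
  filt n u /\ v = \sum_(k < (2 * n.+1).+1) c k *: wvec n.+1 k + u.
Proof.
elim=> {v} [j k /andP[j_gt0] le_j le_k||u v _ [c [u' [Mu' ->]]] _ [d [v' [Mv' ->]]]
  |a u _ [c [u' [Mu' ->]]]].
- move: le_j; rewrite leq_eqVlt => /predU1P[jE|lt_j].
    exists (fun i => (i == k)%:R), 0; split; first exact: filt0.
    have lt_k : (k < (2 * n.+1).+1)%N by rewrite ltnS -jE.
    rewrite addr0 (bigD1 (Ordinal lt_k)) //= eqxx scale1r jE big1 ?addr0 // => i.
    by rewrite -val_eqE /= => /negPf->; rewrite scale0r.
  exists (fun=> 0), (wvec j k); split; first by apply: filt_gen; rewrite ?j_gt0.
  by rewrite big1 ?add0r // => i _; rewrite scale0r.
- exists (fun=> 0), 0; split; first exact: filt0.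
  by rewrite big1 ?add0r // => i _; rewrite scale0r.
- exists (fun k => c k + d k), (u' + v'); split; first exact: filtD.
  rewrite addrACA -big_split; congr (_ + _).
  by apply: eq_bigr => k _; rewrite scalerDl.
- exists (fun k => a * c k), (a *: u'); split; first exact: filtZ.
  rewrite scalerDr scaler_sumr; congr (_ + _).
  by apply: eq_bigr => k _; rewrite scalerA.
Qed.

Lemma symb_sum n m (c : nat -> C) (v : nat -> L) (P : nat -> {poly C}) :
  (forall k, (k < m)%N -> symb n (opval (v k)) (P k)) ->
  symb n (opval (\sum_(k < m) c k *: v k)) (\sum_(k < m) c k *: P k).
Proof.
elim: m => [|m IHm] sv; first by rewrite !big_ord0; apply/symb0/opval0.
rewrite !big_ord_recr /=.
have s1 := IHm (fun k lt_k => sv k (ltnW lt_k)).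
apply: eq_symb (symbD s1 (symbZ (c m) (sv m (ltnSn m)))) => p.
by rewrite opvalD /opD opvalZ.
Qed.

(** The symbols of the [wvec n.+1 k] are nonzero multiples of distinct powers of ['X], so an element
    acting by zero has no component in the top layer. *)
Lemma opval_inj n v : filt n v -> (forall p, opval v p = 0) -> v = 0.
Proof.
elim: n v => [|n IHn] v Mv v0.
  elim: Mv {v0} => [j k /andP[j_gt0]||u u' _ -> _ ->|a u _ ->] //.
  - by rewrite leqNgt j_gt0.
  - by rewrite addr0.
  - by rewrite scaler0.
have [c [u [Mu vE]]] := filt_decomp Mv.
have [a a_neq0 sa] := @symb_wvec n.+1 isT.
have sv : symb n.+1 (opval v)
    (\sum_(k < (2 * n.+1).+1) c k *: (a *: ((-1) ^+ k *: 'X^k)) + 0).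
  rewrite vE; have s1 := @symb_sum n.+1 (2 * n.+1).+1 c (wvec n.+1)
    (fun k => a *: ((-1) ^+ k *: 'X^k)) sa.
  by apply: eq_symb (symbD s1 (filt_symb0 Mu)) => p; rewrite opvalD.
have c0 k : (k < (2 * n.+1).+1)%N -> c k = 0.
  move=> lt_k; have /(congr1 (fun P : {poly C} => P`_k)) := symb_eq0 v0 sv.
  rewrite addr0 coef_sum coef0 (bigD1 (Ordinal lt_k)) //= big1 => [|i].
    rewrite addr0 !coefZ coefXn eqxx mulr1 => /eqP.
    by rewrite !mulf_eq0 signr_eq0 (negPf a_neq0) !orbF => /eqP.
  by rewrite -val_eqE /= eq_sym !coefZ coefXn => /negPf->; rewrite !mulr0.
have {vE} vE : v = u.
  by rewrite vE big1 ?add0r // => k _; rewrite c0 ?scale0r.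
by rewrite vE; apply: IHn => // p; rewrite -vE.
Qed.

End Faithful.

(** * Surjectivity and kernel of the evaluation map *)

Theorem theorem2p6 (R : realType) (lam t : R[i])
  (hlam : forall n : int, lam != n%:~R) (ht : t != 0) :
  (* surjectivity of F -> sl(lam) *)
  (forall f : op R[i], in_gen (slgens lam t) f ->
     exists w : lterm R[i], forall p, lieval (slgens lam t) w p = f p) /\
  (* kernel = ideal generated by the relations *)
  (forall w : lterm R[i],
     (forall p, lieval (slgens lam t) w p = 0) <-> lcong (sl_rels lam t) w LZero).
Proof.
split=> [f|a].
  elim=> {f} [i|f g _ [a fE] _ [b gE]|k f _ [a fE]|f g _ [a fE] _ [b gE]].
  - by exists (LGen i).
  - by exists (LAdd a b) => p; rewrite /= /opD fE gE.
  - by exists (LScale k a) => p; rewrite /= /opZ fE.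
  - by exists (LBr a b) => p; rewrite /= /opBr !(fE, gE).
split=> [a0|/lcong_ev a0 p]; last by rewrite a0.
apply/lclsP.
have [n Mn] := @lalg_spanned _ lam t (lcls (sl_rels lam t) a).
by apply: (opval_inj ht Mn) => p; rewrite opval_cls.
Qed.
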